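(* Let $p$ be a prime and let $P$ be a finite regular $p$-group. Then $\mathrm{cl}(P)\leq f(P)+1$, where $\mathrm{cl}(P)$ is the nilpotency class and $f(P)$ is the coexponent of $P$.
   Context: For a finite $p$-group $P$ of order $p^n$ and exponent $p^e$, the coexponent of $P$ is $f(P)=n-e$. For a finite $p$-group $Q$, let $\mho_1(Q)=\langle x^{p} : x\in Q\rangle$, and let $\gamma_2(Q)=[Q,Q]$. A finite $p$-group $P$ is called regular if for any two elements $x,y\in P$ there exists $z\in \mho_1(\gamma_2(\langle x,y\rangle))$ with $x^p y^p=(xy)^p z$. *)

(* Defs.v *)
From mathcomp Require Import all_boot all_fingroup all_solvable.

Set Implicit Arguments.
Unset Strict Implicit.
Unset Printing Implicit Defensive.

Local Open Scope group_scope.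

(* For a p-group P with #|P| = p ^ n and exponent P = p ^ e this is n - e;
   the subtraction never truncates, as exponent P divides #|P|. *)
Definition coexponent (p : nat) (gT : finGroupType) (P : {set gT}) : nat :=
  (logn p #|P| - logn p (exponent P))%N.

(* Intended for a p-group P: 'Mho^1(Q) takes its prime from the orders of the
   elements of Q, and is then <<[set x ^+ p | x in Q]>> (lemma MhoE). The lower
   central series of the library starts at 1, so 'L_2(Q) = [~: Q, Q]. *)
Definition regular_pgroup (p : nat) (gT : finGroupType) (P : {set gT}) : Prop :=
  forall x y : gT, x \in P -> y \in P ->
  exists2 z : gT, z \in 'Mho^1('L_2(<<[set x; y]>>))
                & x ^+ p * y ^+ p = (x * y) ^+ p * z.

(* Main.v *)
Require Import Defs.
From mathcomp Require Import all_boot all_fingroup all_solvable.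

Set Implicit Arguments.
Unset Strict Implicit.
Unset Printing Implicit Defensive.

Local Open Scope group_scope.

(** Let P be nonabelian, M = Ohm_1(P) and |P : Mho^1(P)| = p^w. As P is not
    cyclic, w > 1, and P / Mho^1(P) has class less than w, so
    L_w(P) <= Mho^1(P). Regularity gives [Mho^1(N), P] <= Mho^1([N, P]) for N
    normal in P, whence L_(w+j)(P) <= Mho^1(L_(j+1)(P)) for all j. By induction
    L_k(P) <= M for k = f(P / M) + 2, so L_(w+k-1)(P) <= Mho^1(L_k(P)) = 1, M
    having exponent p. Finally |P : M| <= |Mho^1(P)|, since x ^+ p = y ^+ p
    forces x and y into the same coset of M; this is |P : Mho^1(P)| <= |M|,
    which yields w + k - 1 <= f(P) + 2. *)

Lemma regular_pgroupS (p : nat) (gT : finGroupType) (G H : {group gT}) :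
  H \subset G -> regular_pgroup p G -> regular_pgroup p H.
Proof. by move=> /subsetP sHG regG x y /sHG Gx /sHG; apply: regG. Qed.

Lemma quotient_regular_pgroup (p : nat) (gT : finGroupType)
    (G H : {group gT}) :
  H <| G -> regular_pgroup p G -> regular_pgroup p (G / H).
Proof.
move=> /andP[_ nHG] regG _ _ /morphimP[x Nx Gx ->] /morphimP[y Ny Gy ->].
have [z Mz Dxy] := regG x y Gx Gy.
have sXN: [set x; y] \subset 'N(H) by rewrite subUset !sub1set Nx.
have sGN: <<[set x; y]>> \subset 'N(H) by rewrite gen_subG.
have sLN: 'L_2(<<[set x; y]>>) \subset 'N(H).
  exact: subset_trans (lcn_sub _ _) sGN.
have Nz: z \in 'N(H) := subsetP (subset_trans (Mho_sub 1 _) sLN) z Mz.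
exists (coset H z); last first.
  rewrite -!morphX // -(morphM _ Nx Ny) -morphX ?groupM //.
  by rewrite -!morphM ?groupX ?groupM // Dxy.
have ->: [set coset H x; coset H y] = [set x; y] / H.
  by rewrite /quotient morphimU !morphim_set1.
rewrite -quotient_gen // /quotient -morphim_lcn // -morphim_Mho //.
by rewrite mem_morphim.
Qed.

(** Modulo the normal closure of [[~ x, y]] the two generators commute, so that quotient is
    abelian. *)
Lemma der1_gen2 (gT : finGroupType) (x y : gT) :
  <<[set x; y]>>^`(1) \subset <<[~ x, y] ^: <<[set x; y]>> >>.
Proof.
set G := <<_>>; set N := <<_>>.
have nNG: G \subset 'N(N) by rewrite norms_gen ?class_norm.
have Gx: x \in G by rewrite mem_gen ?set21.
have Gy: y \in G by rewrite mem_gen ?set22.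
apply: der1_min => //.
have cxy: commute (coset N x) (coset N y).
  apply/commgP; rewrite -morphR ?(subsetP nNG) //.
  by rewrite /= coset_id ?mem_gen ?class_refl.
have sXN: [set x; y] \subset 'N(N) := subset_trans (subset_gen _) nNG.
rewrite quotient_gen // abelian_gen /quotient morphimU.
rewrite !morphim_set1 ?(subsetP nNG) //.
apply/centsP=> a /set2P[]-> b /set2P[]->; by [|apply: commute_sym].
Qed.

(* If x ^+ p = y ^+ p then x and x ^ y have the same p-th power and lie in a
   proper subgroup of <x, y>, so by induction [~ x, y] has order dividing p, as
   do its conjugates, which generate the derived subgroup. By induction again
   that subgroup has exponent dividing p, hence a trivial Mho^1. *)
Lemma regular_expg_eq (p : nat) (gT : finGroupType) (G : {group gT}) x y :
    p.-group G -> regular_pgroup p G -> x \in G -> y \in G ->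
  x ^+ p = y ^+ p -> (x^-1 * y) ^+ p = 1.
Proof.
have [n leGn] := ubnP #|G|; elim: n => // n IHn in G x y leGn *.
move=> pG regG Gx Gy Exy; set H := <<[set x; y]>>%G.
have sHG: H \subset G by rewrite gen_subG subUset !sub1set Gx.
have [Hx Hy]: x \in H /\ y \in H by rewrite !mem_gen ?set21 ?set22.
have pH := pgroupS sHG pG.
pose K := (H^`(1) <*> <[x]>)%G.
have sKH: K \subset H by rewrite join_subG der_sub cycle_subG.
(* The derived subgroup of [H] lies in ['Phi(H)], whose elements are non-generators. So if [K] is
   all of [H], then [x] alone generates [H] and [y] is a power of [x]. *)
have [defK | ltKH] := eqVproper sKH.
  have defH: <[x]> = H :> {set gT}.
    rewrite -[RHS](@Phi_nongen _ H <[x]>) ?genGid //.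
    apply/eqP; rewrite eqEsubset join_subG Phi_sub cycle_subG Hx /=.
    rewrite -{1}defK join_subG joing_subr andbT.
    by rewrite (subset_trans _ (joing_subl _ _)) // (Phi_joing pH) joing_subl.
  have cxy: commute x^-1 y.
    have /cycleP[i ->]: y \in <[x]> by rewrite defH.
    by apply/commuteX/commute_sym/commuteV.
  by rewrite expgMn // expgVn Exy mulVg.
have ltKn: #|K| < n.
  apply: leq_trans (proper_card ltKH) _.
  exact: leq_trans (subset_leq_card sHG) _.
have sKG := subset_trans sKH sHG.
have IHK a b: a \in K -> b \in K -> a ^+ p = b ^+ p -> (a^-1 * b) ^+ p = 1.
  by apply: IHn; rewrite ?(pgroupS sKG) //; apply: regular_pgroupS regG.
have sDK: H^`(1) \subset K := joing_subl _ _.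
have Kx: x \in K by rewrite (subsetP (joing_subr _ _)) ?cycle_id.
have Dxy: [~ x, y] \in H^`(1) by rewrite mem_commg.
have Rp: [~ x, y] ^+ p = 1.
  apply: IHK => //.
    by rewrite conjg_mulR groupM // (subsetP sDK).
  by rewrite -conjXg Exy conjXg conjgE mulKg.
(* Closure under products: [a * b] is [(a^-1)^-1 * b], and [a^-1] and [b] have the same p-th power
   1. *)
have gL: group_set 'Ldiv_p(H^`(1)).
  apply/group_setP; split=> [|a b]; first by rewrite !inE group1 expg1n /=.
  rewrite !inE => /andP[Da /eqP a1] /andP[Db /eqP b1].
  rewrite groupM //= -{1}[a]invgK; apply/eqP; apply: IHK.
  - by rewrite groupV (subsetP sDK).
  - by rewrite (subsetP sDK).
  - by rewrite expgVn a1 b1 invg1.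
have sDL: H^`(1) \subset 'Ldiv_p(H^`(1)).
  have sDN: H^`(1) \subset <<[~ x, y] ^: H>> := der1_gen2 x y.
  apply: subset_trans sDN _; rewrite -(gen_set_id gL).
  apply/genS/subsetP=> _ /imsetP[h Hh ->]; rewrite !inE -conjXg Rp conj1g eqxx.
  by rewrite memJ_norm ?Dxy // (subsetP (der_norm 1 H)).
have [z Mz] := regG x^-1 y (groupVr Gx) Gy.
suffices -> : z = 1 by rewrite mulg1 -Exy expgVn mulVg => <-.
have defH: <<[set x^-1; y]>> = H.
  apply/eqP; rewrite eqEsubset !gen_subG !subUset !sub1set groupV Hx Hy.
  by rewrite -[x \in _]groupV !mem_gen ?set21 ?set22.
move: Mz; rewrite defH lcn2 (MhoE 1 (pgroupS (der_sub 1 H) pH)).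
suffices: <<[set a ^+ (p ^ 1) | a in H^`(1)]>> \subset [1].
  by move=> /subsetP s1 /s1/set1P.
rewrite gen_subG; apply/subsetP=> _ /imsetP[a /(subsetP sDL) La ->].
by move: La; rewrite expn1 !inE => /andP[].
Qed.

Lemma regular_Ohm1 (p : nat) (gT : finGroupType) (G : {group gT}) :
  p.-group G -> regular_pgroup p G -> 'Ohm_1(G) = 'Ldiv_p(G).
Proof.
move=> pG regG; rewrite (OhmE 1 pG) expn1; apply: gen_set_id.
apply/group_setP; split=> [|a b]; first by rewrite !inE group1 expg1n /=.
rewrite !inE => /andP[Ga /eqP a1] /andP[Gb /eqP b1].
rewrite groupM //= -{1}[a]invgK (regular_expg_eq pG regG) ?groupV //.
by rewrite expgVn a1 b1 invg1.
Qed.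

Lemma regular_index_Ohm1 (p : nat) (gT : finGroupType) (G : {group gT}) :
    p.-group G -> regular_pgroup p G ->
  #|G : 'Ohm_1(G)| <= #|'Mho^1(G)|.
Proof.
(* Sending a coset to the p-th power of a chosen representative is injective by [regular_expg_eq],
   and its values lie in ['Mho^1(G)]. *)
move=> pG regG; pose f (A : {set gT}) := repr A ^+ p.
have reprG A: A \in rcosets 'Ohm_1(G) G -> repr A \in G /\ A = 'Ohm_1(G) :* repr A.
  case/rcosetsP=> x Gx ->; have Rx := mem_repr_rcoset 'Ohm_1(G) x.
  split; last by rewrite (rcoset_eqP Rx).
  by case/rcosetP: Rx => u /(subsetP (Ohm_sub 1 G)) Gu ->; rewrite groupM.
rewrite /indexg -(card_in_imset (f := f)); last first.
  move=> A B /reprG[Ga dA] /reprG[Gb dB] fAB; rewrite dA dB.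
  apply: rcoset_eqP; rewrite mem_rcoset /= (regular_Ohm1 pG regG) !inE.
  rewrite groupM ?groupV //= -{1}[repr A]invgK.
  rewrite (regular_expg_eq pG regG) ?groupV //.
  by rewrite !expgVn -/(f A) fAB.
apply/subset_leq_card/subsetP=> _ /imsetP[A /reprG[Ga _] ->].
by rewrite /f -[p in _ ^+ p]expn1 Mho_p_elt ?(mem_p_elt pG).
Qed.

(** Regularity for [x^-1] and [x ^ g] reads [[~ x ^+ p, g] = [~ x, g] ^+ p * z]. As both elements
    lie in [N], the derived subgroup of the group they generate is inside [[~: N, G]], which places
    [z]. *)
Lemma regular_comm_Mho1 (p : nat) (gT : finGroupType) (G N : {group gT}) :
    p.-group G -> regular_pgroup p G -> N <| G ->
  [~: 'Mho^1(N), G] \subset 'Mho^1([~: N, G]).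
Proof.
move=> pG regG /andP[sNG nNG].
have nMG: G \subset 'N('Mho^1([~: N, G])).
  by apply: gFnorm_trans; rewrite normsR // normG.
have nMN := subset_trans sNG nMG.
(* Centralising modulo ['Mho^1([~: N, G])] can be tested on the generators [x ^+ p] of
   ['Mho^1(N)]. *)
rewrite -quotient_cents2 //; last exact: subset_trans (Mho_sub 1 N) nMN.
rewrite (MhoE 1 (pgroupS sNG pG)) quotient_gen; last first.
  by apply/subsetP=> _ /imsetP[x Nx ->]; rewrite groupX ?(subsetP nMN).
rewrite gen_subG quotient_cents2r //.
rewrite gen_subG; apply/subsetP=> _ /imset2P[_ g /imsetP[x Nx ->] Gg ->].
have Gx := subsetP sNG x Nx.
have [z Mz Dz] := regG x^-1 (x ^ g) (groupVr Gx) (groupJ Gx Gg).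
have Rxg: [~ x, g] \in [~: N, G] by rewrite mem_commg.
rewrite expn1 commgEl -expgVn conjXg {}Dz -commgEl.
apply: groupM.
  rewrite -[p in _ ^+ p]expn1 Mho_p_elt //.
  by apply: mem_p_elt pG _; rewrite groupR.
apply: subsetP Mz; apply: MhoS.
have sXN: <<[set x^-1; x ^ g]>> \subset N.
  by rewrite gen_subG subUset !sub1set groupV Nx memJ_norm ?(subsetP nNG).
exact: commgSS sXN (subset_trans sXN sNG).
Qed.

Lemma regular_lcn_Mho1 (p : nat) (gT : finGroupType) (G : {group gT}) w j :
    p.-group G -> regular_pgroup p G -> 'L_w.+1(G) \subset 'Mho^1(G) ->
  'L_(w + j).+1(G) \subset 'Mho^1('L_j.+1(G)).
Proof.
move=> pG regG sLM; elim: j => [|j IHj]; first by rewrite addn0 lcn1.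
rewrite addnS !lcnSn (subset_trans (commSg G IHj)) //.
exact: (regular_comm_Mho1 (N := [group of 'L_j.+1(G)]) pG regG (lcn_normal _ _)).
Qed.

(** Here [w.+1] is the exponent called w in the opening outline. *)
Lemma lcn_sub_Mho1 (p : nat) (gT : finGroupType) (G : {group gT}) :
    p.-group G -> ~~ abelian G ->
  exists2 w, logn p #|G : 'Mho^1(G)| = w.+1 & 'L_w.+1(G) \subset 'Mho^1(G).
Proof.
move=> pG not_cGG; pose M := 'Mho^1(G)%G.
have pQ: p.-group (G / M) := quotient_pgroup _ pG.
have nMG: G \subset 'N(M) := gFnorm _ _.
have cardQ: #|G : M| = #|G / M| by rewrite card_quotient.
(* Otherwise [G / M] is cyclic, hence so is its quotient [G / 'Phi(G)], and then [G] itself. *)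
have Qgt1: 1 < logn p #|G / M|.
  rewrite ltnNge; apply: contra not_cGG => leQ1.
  apply: cyclic_abelian; apply: Phi_quotient_cyclic.
  have sMPhi: M \subset 'Phi(G) by rewrite (Phi_joing pG) joing_subr.
  have /quotient_cyclic: cyclic (G / M).
    have [-> | ntQ] := eqVneq (G / M) 1; first exact: cyclic1.
    have [p_pr _ [m oQ]] := pgroup_pdiv pQ ntQ.
    by rewrite prime_cyclic // oQ; move: leQ1; rewrite oQ pfactorK //; case: (m).
  move/(_ ('Phi(G) / M)%G); rewrite /=.
  by rewrite (isog_cyclic (third_isog sMPhi (gFnormal _ _) (Phi_normal G))).
rewrite cardQ; exists (logn p #|G / M|).-1; first by rewrite (ltn_predK Qgt1).
rewrite -quotient_sub1 ?(subset_trans (lcn_sub _ _)) //.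
rewrite /quotient morphim_lcn // -/(G / M) subG1.
(* A group of order p^m has class at most the maximum of 1 and m - 1, which is m - 1 because [Qgt1]
   gives m > 1. *)
apply/eqP/(lcn_nil_classP _ (pgroup_nil pQ)).
apply: leq_trans (nil_class_pgroup pQ) _.
by rewrite geq_max leqnn andbT -ltnS (ltn_predK Qgt1).
Qed.

Theorem proposition1 (p : nat) (gT : finGroupType) (P : {group gT})
    (p_prime : prime p) (pP : p.-group P) (regP : regular_pgroup p P) :
  (nil_class P <= coexponent p P + 1)%N.
Proof.
have [n lePn] := ubnP #|P|; elim: n => // n IHn in gT P lePn pP regP *.
have [cPP | not_cPP] := boolP (abelian P).
  by rewrite (leq_trans _ (leq_addl _ _)) ?nil_class1.
have [w Dw sLM] := lcn_sub_Mho1 pP not_cPP.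
have ntP: P :!=: 1 by apply: contraNneq not_cPP => ->; apply: abelian1.
pose O := 'Ohm_1(P)%G; have nsO: O <| P := gFnormal _ _.
have nOP := normal_norm nsO; have sOP := normal_sub nsO.
have ntO: O :!=: 1 by rewrite Ohm1_eq1.
have pQ: p.-group (P / O) := quotient_pgroup _ pP.
have leQf: nil_class (P / O) <= coexponent p (P / O) + 1.
  apply: IHn => //; last exact: quotient_regular_pgroup.
  by apply: leq_trans (ltn_quotient ntO sOP) _; rewrite -ltnS.
have LkO: 'L_(coexponent p (P / O) + 1).+1(P) \subset O.
  rewrite -quotient_sub1 ?(subset_trans (lcn_sub _ _)) //.
  rewrite /quotient morphim_lcn // subG1.
  exact/eqP/(lcn_nil_classP _ (pgroup_nil pQ)).
have expO x : x \in O -> x ^+ p = 1.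
  by rewrite /= (regular_Ohm1 pP regP) !inE => /andP[_ /eqP].
have class_le: nil_class P <= w + (coexponent p (P / O) + 1).
  apply/(lcn_nil_classP _ (pgroup_nil pP))/trivgP.
  apply: subset_trans (regular_lcn_Mho1 _ pP regP sLM) _.
  rewrite (MhoE 1 (pgroupS (lcn_sub _ _) pP)) gen_subG.
  apply/subsetP=> _ /imsetP[x /(subsetP LkO)/expO x1 ->].
  by rewrite expn1 x1 group1.
(* The power of [x] by the exponent of [P / O] falls in [O], so one further p-th power kills it. *)
have leE: logn p (exponent P) <= (logn p (exponent (P / O))).+1.
  have dvdE: exponent P %| exponent (P / O) * p.
    apply/exponentP=> x Px; rewrite expgM expO // coset_idr ?groupX //.
      by rewrite (subsetP nOP).
    by rewrite morphX ?(subsetP nOP) // expg_exponent ?mem_quotient.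
  have gt0E: 0 < exponent (P / O) * p by rewrite muln_gt0 exponent_gt0 prime_gt0.
  rewrite (leq_trans (dvdn_leq_log p gt0E dvdE)) //.
  rewrite lognM ?exponent_gt0 ?prime_gt0 // -[X in _ + logn _ X]expn1.
  by rewrite (pfactorK 1 p_prime) addn1.
have logP: logn p #|P| = logn p #|O| + logn p #|P / O|.
  by rewrite card_quotient // -(Lagrange sOP) lognM ?indexg_gt0 ?cardG_gt0.
(* Both [O] and ['Mho^1(P)] are compared with [P] by Lagrange, turning |P : O| <= |Mho^1(P)| into |P
   : Mho^1(P)| <= |O|. *)
have leW: w.+1 <= logn p #|O|.
  have pM: p.-group 'Mho^1(P) := pgroupS (Mho_sub 1 P) pP.
  have leQM: logn p #|P / O| <= logn p #|'Mho^1(P)|.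
    rewrite -(leq_exp2l _ _ (prime_gt1 p_prime)) -(card_pgroup pQ) -(card_pgroup pM).
    by rewrite card_quotient // (regular_index_Ohm1 pP).
  rewrite -(leq_add2r (logn p #|P / O|)) -logP -(Lagrange (Mho_sub 1 P)).
  by rewrite lognM ?indexg_gt0 ?cardG_gt0 // Dw addnC leq_add2r.
have leEQ: logn p (exponent (P / O)) <= logn p #|P / O|.
  by rewrite dvdn_leq_log ?cardG_gt0 ?exponent_dvdn.
(* The factor p that [leE] may add to the exponent is paid for by the successor in [leW]; [leEQ]
   keeps the natural subtraction from truncating. *)
apply: leq_trans class_le _; rewrite /coexponent addnA leq_add2r.
apply: leq_trans (leq_sub2l _ leE).
by rewrite addnBA // logP -subSS -addSn leq_sub2r ?leq_add2r.
Qed.
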